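(* For every real $\lambda>1$ there do not exist positive constants $\alpha$ and $C$ with the following property: for all positive integers $p\le n$, every set $K$ of at least $\lambda^p$ vectors in $\{0,1\}^n$, each of Hamming weight $p$, contains a subset $K'$ with $|K'|\ge |K|^{\alpha}$ and ${\rm dr}(K')\le C$. Equivalently: for all reals $\alpha>0$, $C>0$ and $\lambda>1$ there exist positive integers $p\le n$ and a set $K$ of at least $\lambda^p$ vectors in $\{0,1\}^n$, each of Hamming weight $p$, such that no subset $K'\subseteq K$ with $|K'|\ge |K|^{\alpha}$ satisfies ${\rm dr}(K')\le C$.
   Context: The Hamming weight $|v|$ of $v\in\{0,1\}^n$ is the sum of its coordinates. The Hamming distance $\rho(u,v)$ between $u,v\in\{0,1\}^n$ is the number of coordinates in which they differ. For a set $L\subseteq\{0,1\}^n$ with at least two elements, the distance ratio is ${\rm dr}(L)=\max\{\rho(x,y): x,y\in L\}/\min\{\rho(x,y): x,y\in L,\ x\ne y\}$. A set with fewer than two elements is not considered to satisfy ${\rm dr}\le C$. *)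

(* Defs.v *)
From mathcomp Require Import all_boot all_order all_algebra.
From mathcomp Require Import reals.

Set Implicit Arguments.
Unset Strict Implicit.
Unset Printing Implicit Defensive.

Import Order.TTheory GRing.Theory Num.Theory.
Local Open Scope ring_scope.

Definition cube (n : nat) : finType := {ffun 'I_n -> bool}.

Definition hweight (n : nat) (v : cube n) : nat := (\sum_(i < n) v i)%N.

Definition hdist (n : nat) (u v : cube n) : nat := #|[set i | u i != v i]|.

Definition max_dist (n : nat) (L : {set cube n}) : nat :=
  (\max_(xy in setX L L) hdist xy.1 xy.2)%N.

(* The default value n never affects the result when L has two distinct
   elements, since hdist is at most n. *)
Definition min_dist (n : nat) (L : {set cube n}) : nat :=
  \big[minn/n]_(xy in setX L L | xy.1 != xy.2) hdist xy.1 xy.2.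

Definition dr (R : realType) (n : nat) (L : {set cube n}) : R :=
  (max_dist L)%:R / (min_dist L)%:R.

(* The ratio is only meaningful for at least two elements; a smaller set does
   not satisfy the bound, whatever value dr takes on it. *)
Definition dr_le (R : realType) (n : nat) (L : {set cube n}) (C : R) : Prop :=
  (1 < #|L|)%N /\ dr R L <= C.

(* Main.v *)
(** The vectors are the leaves of a tree of depth d with branching m, each leaf
    being encoded by the characteristic vector of the path leading to it, where a
    node at height i counts for B ^ i coordinates.  Two leaves whose paths split
    at height j are then at distance 2 (1 + B + ... + B ^ j), so for B large
    compared with C the pairs of a set of distance ratio at most C all split at
    the same height, and such a set has at most m of the m ^ d elements.  The
    weight p depends only on d and B, so m can be chosen with m >= lambda ^ p,
    while d alpha > 1 makes (m ^ d) ^ alpha exceed m. *)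

Require Import Defs.
From mathcomp Require Import all_boot all_order all_algebra.
From mathcomp Require Import reals exp.

Set Implicit Arguments.
Unset Strict Implicit.
Unset Printing Implicit Defensive.

Import Order.TTheory GRing.Theory Num.Theory.
Local Open Scope ring_scope.

Lemma sum_pred1 (T : finType) (a : T) : (\sum_(s : T) (s == a) = 1)%N.
Proof.
by rewrite (bigD1 a) //= eqxx big1 ?addn0 // => s /negPf ->.
Qed.

(** The geometric sum with base [c.+1]: the left side is exactly [c.+1 ^ j - 1]. *)
Lemma mul_sum_expn_lt (c j : nat) : (c * \sum_(i < j) c.+1 ^ i < c.+1 ^ j)%N.
Proof.
by rewrite -[X in (X * _)%N]/(c.+1.-1) -predn_exp prednK ?expn_gt0.
Qed.

Lemma hweight_le (n : nat) (v : cube n) : (hweight v <= n)%N.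
Proof.
rewrite -[X in (_ <= X)%N]card_ord -sum1_card.
by apply: leq_sum => i _; case: (v i).
Qed.

Lemma hdist_le (n : nat) (u v : cube n) : (hdist u v <= n)%N.
Proof. by rewrite -[X in (_ <= X)%N]card_ord max_card. Qed.

Lemma hdist_gt0 (n : nat) (u v : cube n) : u != v -> (0 < hdist u v)%N.
Proof.
move=> uv; rewrite card_gt0; apply: contraNneq uv => E.
apply/eqP/ffunP => i; apply/eqP.
by move/setP/(_ i): E; rewrite !inE => /negbFE.
Qed.

Lemma hdist_le_max_dist (n : nat) (L : {set cube n}) (u v : cube n) :
  u \in L -> v \in L -> (hdist u v <= max_dist L)%N.
Proof.
move=> uL vL.
by apply: (@leq_bigmax_cond _ (mem (setX L L)) (fun xy => hdist xy.1 xy.2) (u, v));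
  rewrite !inE uL.
Qed.

Lemma min_dist_le_hdist (n : nat) (L : {set cube n}) (u v : cube n) :
  u \in L -> v \in L -> u != v -> (min_dist L <= hdist u v)%N.
Proof.
move=> uL vL uv; rewrite /min_dist -minEnat -leEnat.
by apply: (@bigmin_le_cond _ _ _ _ (u, v) _ (fun xy => hdist xy.1 xy.2));
  rewrite !inE /= uL vL.
Qed.

(** The default value [n] enters the minimum along with the distances, so it has to be positive
    too. *)
Lemma min_dist_gt0 (n : nat) (L : {set cube n}) : (0 < n)%N -> (0 < min_dist L)%N.
Proof.
move=> n0; apply: (big_ind (fun m => 0 < m)%N) => //.
  by move=> a b a0 b0; rewrite leq_min a0.
by move=> xy /andP[_]; exact: hdist_gt0.
Qed.

(** Clears the denominator of the ratio, so that any two pairs of points of [L] can be compared. *)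
Lemma dr_le_hdist (R : realType) (n : nat) (L : {set cube n}) (C : R)
    (x y z u : cube n) :
  dr_le L C -> x \in L -> y \in L -> z \in L -> u \in L -> z != u -> 0 <= C ->
  (hdist x y)%:R <= C * (hdist z u)%:R.
Proof.
move=> [_ drL] xL yL zL uL zu C0.
have n0 : (0 < n)%N := leq_trans (hdist_gt0 zu) (hdist_le z u).
move: drL; rewrite /dr ler_pdivrMr ?ltr0n ?min_dist_gt0// => maxL.
apply: le_trans (le_trans maxL _); first by rewrite ler_nat hdist_le_max_dist.
by rewrite ler_wpM2l// ler_nat min_dist_le_hdist.
Qed.

(** Allows coordinates to be indexed by any finite type, here by copies of tree nodes. *)
Definition vec (T : finType) (f : T -> bool) : cube #|T| :=
  [ffun i => f (enum_val i)].

Lemma hweight_vec (T : finType) (f : T -> bool) : hweight (vec f) = (\sum_t f t)%N.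
Proof.
by rewrite [RHS]big_enum_val /hweight; apply: eq_bigr => i _; rewrite ffunE.
Qed.

Lemma hdist_vec (T : finType) (f g : T -> bool) :
  hdist (vec f) (vec g) = (\sum_t (f t != g t))%N.
Proof.
rewrite [RHS]big_enum_val /hdist -sum1_card big_mkcond /=.
by apply: eq_bigr => i _; rewrite inE !ffunE; case: (_ != _).
Qed.

Section Tree.
Variables (d B : nat) (A : finType) (a0 : A).

Let leaf := {ffun 'I_d -> A}.

(* The ancestor at height i of a leaf is encoded by the letters of index at
   least i, the others being reset to a0. *)
Definition ancestor (i : 'I_d) (x : leaf) : leaf :=
  [ffun k : 'I_d => if (i <= k)%N then x k else a0].

(** The factor ['I_(B ^ i)] provides the copies of a node at height [i]. A node is stored as a full
    leaf; leaves not of the form [ancestor i x] only give coordinates that vanish on all path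
    vectors. *)
Definition coordinate : finType := {i : 'I_d & ('I_(B ^ i) * leaf)%type}.

Definition path_pred (x : leaf) (q : coordinate) : bool :=
  (tagged q).2 == ancestor (tag q) x.

Definition path_vec (x : leaf) : cube #|coordinate| := vec (path_pred x).

Lemma sum_coordinate (F : forall i : 'I_d, leaf -> nat) :
  (\sum_(q : coordinate) F (tag q) (tagged q).2 =
   \sum_(i < d) B ^ i * \sum_s F i s)%N.
Proof.
rewrite -(sig_big_dep xpredT (fun (i : 'I_d) _ => true)
            (fun (i : 'I_d) (q : 'I_(B ^ i) * leaf) => F i q.2)) /=.
apply: eq_bigr => i _.
by rewrite -(pair_bigA _ (fun=> F i)) /= sum_nat_const card_ord.
Qed.

Lemma hweight_path_vec (x : leaf) : hweight (path_vec x) = (\sum_(i < d) B ^ i)%N.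
Proof.
rewrite hweight_vec (sum_coordinate (fun i s => s == ancestor i x)).
by apply: eq_bigr => i _; rewrite sum_pred1 muln1.
Qed.

(** Each path has one node per height; two different nodes at height [i] account for two differing
    coordinates in each of the [B ^ i] copies. *)
Lemma hdist_path_vec (x y : leaf) :
  hdist (path_vec x) (path_vec y) =
  (\sum_(i < d) B ^ i * (2 * (ancestor i x != ancestor i y)))%N.
Proof.
rewrite hdist_vec.
rewrite (sum_coordinate (fun i s => (s == ancestor i x) != (s == ancestor i y))).
apply: eq_bigr => i _; congr (_ * _)%N.
case: (eqVneq (ancestor i x) (ancestor i y)) => [->|xy] /=.
  by rewrite big1 // => s _; rewrite eqxx.
transitivity (\sum_s ((s == ancestor i x) + (s == ancestor i y)))%N; last first.
  by rewrite big_split /= !sum_pred1.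
apply: eq_bigr => s _.
by have [->|_] := eqVneq s (ancestor i x); [rewrite (negPf xy) | case: (s == _)].
Qed.

Lemma hdist_path_vec_ge (x y : leaf) (j : 'I_d) :
  x j != y j -> (2 * B ^ j <= hdist (path_vec x) (path_vec y))%N.
Proof.
move=> xy; rewrite hdist_path_vec (bigD1 j) //=.
suff -> : ancestor j x != ancestor j y by rewrite muln1 mulnC leq_addr.
by apply: contraNneq xy => /ffunP/(_ j); rewrite !ffunE leqnn => ->.
Qed.

(** Leaves that agree from index [j] on share their ancestors at all heights [i >= j], so only
    heights below [j] contribute. *)
Lemma hdist_path_vec_le (x y : leaf) (j : 'I_d) :
  (forall k : 'I_d, (j <= k)%N -> x k = y k) ->
  (hdist (path_vec x) (path_vec y) <= 2 * \sum_(i < j) B ^ i)%N.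
Proof.
move=> xy; rewrite hdist_path_vec big_distrr /=.
rewrite (big_ord_widen _ (fun i => 2 * B ^ i)%N (ltnW (ltn_ord j))).
rewrite [leqRHS]big_mkcond /=; apply: leq_sum => i _.
case: ltnP => [_|ji].
  by rewrite mulnCA leq_mul2l; case: (_ != _); rewrite ?muln0 ?muln1 ?leqnn orbT.
suff -> : ancestor i x = ancestor i y by rewrite eqxx !muln0.
apply/ffunP => k; rewrite !ffunE; case: leqP => // ik.
by apply: xy; apply: leq_trans ik.
Qed.

Lemma path_vec_inj : (0 < B)%N -> injective path_vec.
Proof.
move=> B0 x y xy; apply/ffunP => j; apply/eqP; apply: contraTT isT => nxy.
have := hdist_path_vec_ge nxy.
rewrite xy hdist_path_vec big1 => [|i _]; last by rewrite eqxx !muln0.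
by rewrite leqn0 muln_eq0 expn_eq0 /= -leqn0 leqNgt B0.
Qed.

End Tree.

Lemma dr_le_path_vec_card (R : realType) (d c : nat) (A : finType) (a0 : A)
    (C : R) (L : {set cube #|coordinate d c.+1 A|}) :
  0 <= C -> C <= c%:R -> L \subset [set path_vec c.+1 a0 x | x : {ffun 'I_d -> A}] ->
  dr_le L C -> (#|L| <= #|A|)%N.
Proof.
move=> C0 Cc /subsetP LK drL.
pose V := @path_vec d c.+1 A a0.
have Vinj : injective V by exact: path_vec_inj.
pose M := V @^-1: L.
have LE : L = V @: M.
  apply/setP => v; apply/idP/imsetP => [vL|[x xM ->]]; last by rewrite inE in xM.
  by have /imsetP[x _ vx] := LK v vL; exists x; rewrite // inE -[V x]vx.
have [j0 sep0] : exists j : 'I_d, [exists x in M, exists y in M, x j != y j].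
  have /card_gt1P[u [v [uL vL uv]]] := drL.1.
  have /imsetP[x _ ux] := LK u uL; have /imsetP[y _ vy] := LK v vL.
  have xy : x != y by apply: contraNneq uv => xy; rewrite ux vy xy.
  have [j xyj] : exists j, x j != y j.
    apply/existsP; apply: contraNT xy; rewrite negb_exists => /forallP xy.
    by apply/eqP/ffunP => j; apply/eqP; rewrite -[_ == _]negbK.
  exists j; apply/existsP; exists x; rewrite inE -[V x]ux uL.
  by apply/existsP; exists y; rewrite inE -[V y]vy vL.
(* Let [j] be the largest index at which two leaves of [M] differ; the letter at [j] then determines
   a leaf of [M]. *)
case: (@arg_maxnP _ j0 (fun j => [exists x in M, exists y in M, x j != y j])
         (fun j => j : nat) sep0) => j /existsP[x /andP[xM /existsP[y /andP[yM xyj]]]] jmax.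
rewrite LE card_imset //.
rewrite -(card_in_imset (f := fun z : {ffun 'I_d -> A} => z j)) ?max_card //.
move=> z u zM uM zuj; apply/eqP; apply: contraT => zu.
have agree (k : 'I_d) : (j <= k)%N -> z k = u k.
  rewrite leq_eqVlt => /predU1P[/val_inj <-//|jk].
  apply/eqP; apply: contraTT jk => zuk; rewrite -leqNgt; apply: jmax.
  by apply/existsP; exists z; rewrite zM; apply/existsP; exists u; rewrite uM.
have VzVu : V z != V u by rewrite (inj_eq Vinj).
rewrite !inE in xM yM zM uM.
have := dr_le_hdist drL xM yM zM uM VzVu C0.
(* This bound is contradicted by [C * hdist (V z) (V u) <= 2 * c * \sum_(i < j) c.+1 ^ i < 2 * c.+1
   ^ j <= hdist (V x) (V y)]. *)
rewrite leNgt => /negP[].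
have le1 : C * (hdist (V z) (V u))%:R <= c%:R * (hdist (V z) (V u))%:R.
  by rewrite ler_wpM2r.
apply: le_lt_trans le1 _; rewrite -natrM ltr_nat.
apply: leq_trans (hdist_path_vec_ge c.+1 a0 xyj).
apply: leq_ltn_trans (leq_mul (leqnn c) (hdist_path_vec_le c.+1 a0 agree)) _.
by rewrite mulnCA ltn_pmul2l// mul_sum_expn_lt.
Qed.

Theorem theorem1 (R : realType) (lambda : R) (hlambda : 1 < lambda) :
  ~ exists alpha C : R,
      [/\ 0 < alpha, 0 < C &
          forall (p n : nat), (0 < p)%N -> (p <= n)%N ->
          forall K : {set cube n},
            lambda ^+ p <= #|K|%:R ->
            (forall v, v \in K -> hweight v = p) ->
            exists K' : {set cube n},
              [/\ K' \subset K,
                  #|K|%:R `^ alpha <= #|K'|%:R :> R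
                & dr_le K' C]].
Proof.
move=> [alpha [C [alpha0 C0 H]]].
have bound (x : R) : 0 <= x -> exists k : nat, x < k.+1%:R.
  move=> x0; exists (Num.bound x).
  by rewrite (lt_le_trans (archi_boundP x0)) // ler_nat.
have [d hd] : exists d : nat, alpha^-1 < d.+1%:R by apply: bound; rewrite invr_ge0 ltW.
(* Since [C <= c.+1], the base of the node multiplicities is taken to be [c.+2]. *)
have [c /ltW hc] := bound C (ltW C0).
set p := (\sum_(i < d.+1) c.+2 ^ i)%N.
have [m hm] : exists m : nat, lambda ^+ p < m.+1%:R.
  by apply: bound; rewrite exprn_ge0 // ltW // (lt_trans ltr01).
pose V := @path_vec d.+1 c.+2 'I_m.+1 ord0.
pose K := [set V x | x in {: {ffun 'I_d.+1 -> 'I_m.+1}}].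
have p0 : (0 < p)%N by rewrite /p big_ord_recl.
have pn : (p <= #|coordinate d.+1 c.+2 'I_m.+1|)%N.
  rewrite /p -(hweight_path_vec c.+2 (ord0 : 'I_m.+1) [ffun=> ord0]).
  exact: hweight_le.
have cardK : #|K| = (m.+1 ^ d.+1)%N.
  by rewrite card_imset ?card_ffun ?card_ord //; exact: path_vec_inj.
(* Strictness makes [ln m.+1] positive, as the final comparison of exponents requires. *)
have m1 : 1 < m.+1%:R :> R by apply: le_lt_trans hm; rewrite exprn_ege1 // ltW.
have [|_ /imsetP[x _ ->]|K' [K'K cardK' drK']] := H p _ p0 pn K.
- rewrite cardK (le_trans (ltW hm)) // ler_nat.
  by rewrite -[X in (X <= _)%N]expn1 leq_exp2l // -(ltr_nat R).
- exact: hweight_path_vec.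
move: cardK'; rewrite leNgt => /negP[].
have := dr_le_path_vec_card (ltW C0) hc K'K drK'.
rewrite card_ord -(ler_nat R) => /le_lt_trans; apply.
(* Both sides become powers of [m.+1], with exponents [1] and [d.+1 * alpha], and [hd] says that the
   second is larger. *)
rewrite cardK natrX -powR_mulrn ?ler0n // -powRrM -[X in X < _]powRr1 ?ler0n //.
rewrite /powR gt_eqF ?ltr0n // ltr_expR ltr_pM2r ?ln_gt0 //.
by rewrite -ltr_pdivrMr // mul1r.
Qed.
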